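(* Let $q\geq 4$ and let $S$ be a semi-resolving set in $\mathrm{PG}(2,q)$ with $|S|<2q+q/4-3$. Then there is a set $A$ of at most two points such that $S\cup A$ is a double blocking set.
   Context: $\mathrm{PG}(2,q)$ is the Desarguesian projective plane of order $q$. A set $S$ of points is a semi-resolving set if there is at most one line disjoint from $S$ and through every point of $S$ there is at most one line meeting $S$ in exactly one point (equivalently, lines have pairwise distinct ordered distance lists to $S$ in the point-line incidence graph). A double blocking set is a set of points meeting every line in at least two points. *)

(* Defs.v *)
From HB Require Import structures.
From mathcomp Require Import all_boot all_order all_algebra.

Set Implicit Arguments.
Unset Strict Implicit.
Unset Printing Implicit Defensive.

Import Order.TTheory GRing.Theory Num.Theory.

HB.instance Definition _ (F : finFieldType) (vT : vectType F) :=
  isCountable.Build {vspace vT}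
    (pcan_pickleK (can_pcan (@VectorInternalTheory.vs2mxK F vT))).
HB.instance Definition _ (F : finFieldType) (vT : vectType F) :=
  isFinite.Build {vspace vT}
    (pcan_enumP (can_pcan (@VectorInternalTheory.vs2mxK F vT))).

(* PG(2, q) with q = #|F|: points and lines are the subspaces of F^3 of vector *)
(* space dimension 1 and 2, and incidence is inclusion. *)
Definition point (F : finFieldType) : finType :=
  {U : {vspace 'rV[F]_3} | \dim U == 1}.

Definition line (F : finFieldType) : finType :=
  {U : {vspace 'rV[F]_3} | \dim U == 2}.

Definition points_on (F : finFieldType) (l : line F) : {set point F} :=
  [set p | (val p <= val l)%VS].

Definition skew (F : finFieldType) (S : {set point F}) (l : line F) : bool :=
  [disjoint points_on l & S].

Definition tangent (F : finFieldType) (S : {set point F}) (l : line F) : bool :=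
  #|points_on l :&: S| == 1.

Definition semi_resolving (F : finFieldType) (S : {set point F}) : bool :=
  (#|[set l : line F | skew S l]| <= 1) &&
  [forall p in S,
     #|[set l : line F | (p \in points_on l) && tangent S l]| <= 1].

Definition double_blocking (F : finFieldType) (S : {set point F}) : bool :=
  [forall l : line F, 2 <= #|points_on l :&: S|].

(* Main.v *)
Require Import Defs.
From mathcomp Require Import all_boot all_order all_algebra.
From mathcomp Require Import perm zify ring lra.

(** Give a line [l] the index [2 - |l \cap S|] (truncated at [0]), a point the
    sum of the indices of the lines through it, and let [d] be the total index
    of all lines.  Semi-resolvability gives [d <= |S| + 2].

    Let [p] be a point outside [S] lying on some line that meets [S] at least
    twice; take that line as the line at infinity, with one of its points in
    [S] as the vertical direction.  For each slope [m] the degree of the gcd of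
    [\prod_((x, y) \in S) (B + m x - y)] and [\prod_b (B - b)^2] is [2 q] minus
    the index of the point at infinity of slope [m], so the Szonyi-Weiner lemma
    (which bounds the variation in [m] of such a degree through the zeros of a
    subresultant) yields [t^2 - (3 q + 1 - |S|) t + d >= 0] for the index [t]
    of [p].  Hence every index is at most [2] or very large.  At most two points
    can have a large index, and adding them to [S] gives a double blocking set:
    a line still met at most once would force [d] below what the quadratic
    inequality allows at its points of index [1] or [2]. *)

Set Implicit Arguments.
Unset Strict Implicit.
Unset Printing Implicit Defensive.

Import Order.TTheory GRing.Theory Num.Theory.
(* [all_algebra] also exports a constant named [skew]. *)
Import Defs.

Local Open Scope ring_scope.

(** * The Szonyi-Weiner lemma *)

(** Every term of the Leibniz expansion has degree at most the sum of the [r i] minus the sum of the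
    [c j], because a permutation only reorders the column weights. *)
Lemma size_det_weighted (R : idomainType) (N : nat) (A : 'M[{poly R}]_N)
    (r c : 'I_N -> nat) (d : nat) :
    (forall i j, A i j != 0 -> ((size (A i j)).-1 + c j <= r i)%N) ->
    (\sum_i r i <= d + \sum_j c j)%N ->
  (size (\det A) <= d.+1)%N.
Proof.
move=> hA hd; apply: leq_trans (size_sum _ _ _) _; apply/bigmax_leqP => s _.
rewrite size_Msign; have [->|] := eqVneq (\prod_i A i (s i)) 0.
  by rewrite size_poly0.
rewrite prodf_seq_neq0 => /allP nz.
have {}nz i : A i (s i) != 0 by apply: nz; rewrite mem_index_enum.
rewrite size_prod //.
have -> : (\sum_i size (A i (s i)) = \sum_i (size (A i (s i))).-1 + N)%N.
  rewrite -[X in (_ + X)%N]card_ord -sum1_card -big_split /=.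
  by apply: eq_bigr => i _; rewrite addn1 prednK // size_poly_gt0.
rewrite card_ord -addSn addnK ltnS -(leq_add2r (\sum_j c j)%N).
apply: leq_trans hd.
rewrite [X in (_ + X <= _)%N](reindex_inj (@perm_inj _ s)) /= -big_split /=.
by apply: leq_sum => i _; apply: hA.
Qed.

(** A constant invertible row transformation, taken from the rank decomposition of the value of [A]
    at [y], makes all rows beyond the rank vanish at [y]. Each of these rows contributes a factor
    ['X - y%:P]. *)
Lemma det_multiplicity_corank (F : fieldType) (N : nat) (A : 'M[{poly F}]_N)
    (y : F) :
  ('X - y%:P) ^+ (N - \rank (map_mx (horner_eval y) A)) %| \det A.
Proof.
set B := map_mx _ A; set rk := \rank B.
pose P := map_mx polyC (invmx (col_ebase B)).
have detP : \det P = (\det (invmx (col_ebase B)))%:P by rewrite det_map_mx.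
have detP_neq0 : \det (invmx (col_ebase B)) != 0.
  by rewrite -unitfE -unitmxE unitmx_inv col_ebase_unit.
pose C := P *m A.
have C_low (i j : 'I_N) : (rk <= i)%N -> root (C i j) y.
  move=> le_rk_i; have : map_mx (horner_eval y) C = pid_mx rk *m row_ebase B.
    rewrite map_mxM -map_mx_comp.
    have -> : map_mx (horner_eval y \o polyC) (invmx (col_ebase B))
              = invmx (col_ebase B).
      by apply/matrixP => a b; rewrite !mxE /= /horner_eval hornerC.
    rewrite -/B -[X in _ *m X](mulmx_ebase B) !mulmxA mulVmx ?mul1mx //.
    exact: col_ebase_unit.
  move/matrixP/(_ i j); rewrite !mxE /root => CE.
  move: CE; rewrite -[horner_eval y _]/((_).[y]) => ->; apply/eqP.
  by rewrite big1 // => l _; rewrite !mxE ltnNge le_rk_i andbF mul0r.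
pose D : 'rV[{poly F}]_N := \row_i (if (rk <= i)%N then 'X - y%:P else 1).
pose C' := \matrix_(i, j) (if (rk <= i)%N then C i j %/ ('X - y%:P) else C i j).
have CE : C = diag_mx D *m C'.
  apply/matrixP => i j; rewrite mul_diag_mx [RHS]mxE [D 0 i]mxE [C' i j]mxE.
  case: (boolP (rk <= i)%N) => [le_i|]; last by rewrite mul1r.
  by rewrite mulrC divpK // dvdp_XsubCl C_low.
have : \det (diag_mx D) %| \det P * \det A.
  by rewrite -det_mulmx -/C CE det_mulmx dvdp_mulr.
rewrite det_diag detP mul_polyC dvdpZr //.
suff -> : \prod_(i < N) D 0 i = ('X - y%:P) ^+ (N - rk) by [].
under eq_bigr do rewrite mxE.
rewrite -(big_mkord xpredT (fun i => if (rk <= i)%N then 'X - y%:P else 1)).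
rewrite (big_cat_nat (n := rk)) ?rank_leq_row //= big_nat big1 ?mul1r => [|i].
  rewrite -prodr_const_nat !big_nat; apply: eq_bigr => i /andP[-> _] //.
by move=> /andP[_ lt_i]; rewrite leqNgt lt_i.
Qed.

(** * Subresultants and the degree of a gcd *)

Section Subresultant.

Variables (R : comNzRingType) (u v : {poly R}) (k a b : nat).

(** If [u] and [v] have degrees [n] and [m], then for [a = m - k] and [b = n - k] the determinant
    is, up to sign, the principal subresultant coefficient of order [k]; for [k = 0] it is the
    resultant. *)
Definition subresultant_mx : 'M[R]_(a + b) :=
  col_mx (\matrix_(i < a, j < a + b) ('X^i * u)`_(k + j))
         (\matrix_(i < b, j < a + b) ('X^i * v)`_(k + j)).

(** Row vectors encode pairs of cofactors, so the left kernel consists of the combinations of [u]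
    and [v] whose coefficients vanish in the window of [a + b] indices starting at [k]. *)
Lemma mul_subresultant_mx (w : 'rV_(a + b)) (j : 'I_(a + b)) :
  (w *m subresultant_mx) 0 j =
  (rVpoly (lsubmx w) * u + rVpoly (rsubmx w) * v)`_(k + j).
Proof.
have coef_mul d (x : 'rV[R]_d) (p : {poly R}) :
    (rVpoly x * p)`_(k + j) = \sum_(i < d) x 0 i * ('X^i * p)`_(k + j).
  rewrite {1}(row_sum_delta x) linear_sum mulr_suml coef_sum.
  by apply: eq_bigr => i _; rewrite linearZ /= rVpoly_delta -scalerAl coefZ.
rewrite -{1}(hsubmxK w) mul_row_col coefD !coef_mul !mxE.
by congr (_ + _); apply: eq_bigr => i _; rewrite !mxE.
Qed.

End Subresultant.

Lemma map_subresultant_mx (R R' : comNzRingType) (f : {rmorphism R -> R'})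
    (u v : {poly R}) (k a b : nat) :
  map_mx f (subresultant_mx u v k a b) =
  subresultant_mx (map_poly f u) (map_poly f v) k a b.
Proof.
rewrite map_col_mx; congr col_mx; apply/matrixP => i j;
  by rewrite !mxE -coef_map rmorphM /= map_polyXn.
Qed.

Section SubresultantRank.

Variables (F : fieldType) (u v : {poly F}) (n m k : nat).
Hypotheses (size_u : size u = n.+1) (size_v : size v = m.+1).

Let g := gcdp u v.
Let M := subresultant_mx u v k (m - k) (n - k).

Let u_neq0 : u != 0. Proof. by rewrite -size_poly_gt0 size_u. Qed.
Let v_neq0 : v != 0. Proof. by rewrite -size_poly_gt0 size_v. Qed.
Let g_neq0 : g != 0. Proof. by rewrite gcdp_eq0 (negPf u_neq0). Qed.
Let uE : u = u %/ g * g. Proof. by rewrite divpK ?dvdp_gcdl. Qed.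
Let vE : v = v %/ g * g. Proof. by rewrite divpK ?dvdp_gcdr. Qed.
Let size_u' : size (u %/ g) = (n - (size g).-1).+1.
Proof.
rewrite size_divp // size_u subSn // -ltnS prednK ?size_poly_gt0 //.
by rewrite -size_u dvdp_leq ?dvdp_gcdl.
Qed.
Let size_v' : size (v %/ g) = (m - (size g).-1).+1.
Proof.
rewrite size_divp // size_v subSn // -ltnS prednK ?size_poly_gt0 //.
by rewrite -size_v dvdp_leq ?dvdp_gcdr.
Qed.

(** A kernel vector gives [x * u + z * v] of degree below [k] and divisible by [g], hence zero. Then
    [v %/ g] divides [x], which is too short unless it is zero. *)
Lemma subresultant_mx_unit : size g = k.+1 -> M \in unitmx.
Proof.
move=> size_g; rewrite -row_free_unit; apply: inj_row_free => w wM0.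
set x := rVpoly (lsubmx w); set z := rVpoly (rsubmx w).
have le_k_m : (k <= m)%N by rewrite -ltnS -size_g -size_v dvdp_leq ?dvdp_gcdr.
have le_k_n : (k <= n)%N by rewrite -ltnS -size_g -size_u dvdp_leq ?dvdp_gcdl.
have size_x : (size x <= m - k)%N by apply: size_poly.
have size_z : (size z <= n - k)%N by apply: size_poly.
have xz0 : x * u + z * v = 0.
  apply/eqP/negPn/negP => nz.
  have : (size g <= size (x * u + z * v)%R)%N.
    by apply: dvdp_leq; rewrite // dvdp_add // dvdp_mull ?dvdp_gcdl ?dvdp_gcdr.
  (* Coefficients inside the window vanish because [w] is in the kernel, those above it by the size
     bounds on [x] and [z]. *)
  rewrite size_g ltnNge => /negP; apply; apply/leq_sizeP => j le_kj.
  have [lt_j|ge_j] := ltnP (j - k) (m - k + (n - k)).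
    have := mul_subresultant_mx u v k w (Ordinal lt_j).
    by rewrite wM0 mxE /= subnKC.
  rewrite nth_default //; apply: leq_trans (size_polyD _ _) _.
  rewrite geq_max; apply/andP; split; apply: leq_trans (size_polyMleq _ _) _;
    rewrite ?size_u ?size_v; lia.
have x0 : x = 0.
  apply/eqP/negPn/negP => x_neq0.
  have : v %/ g %| x.
    rewrite -(@Gauss_dvdpl _ x (u %/ g)); last first.
      by rewrite coprimep_sym coprimep_div_gcd // u_neq0.
    rewrite -(dvdp_mul2r _ _ g_neq0) -vE -mulrA -uE.
    by move: xz0 => /eqP; rewrite addr_eq0 => /eqP ->; rewrite -mulNr dvdp_mull.
  by move/(dvdp_leq x_neq0); rewrite size_v' size_g ltnNge size_x.
have z0 : z = 0.
  move: xz0; rewrite x0 mul0r add0r => /eqP; rewrite mulf_eq0 (negPf v_neq0).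
  by rewrite orbF => /eqP.
rewrite -[w]hsubmxK -[lsubmx w]rVpolyK -[rsubmx w]rVpolyK -/x -/z x0 z0.
by rewrite !linear0 row_mx0.
Qed.

(** The cofactor pairs [c * (v %/ g)] and [- c * (u %/ g)] combine [u] and [v] to zero. Those with
    [c] of size at most [deg g - k] fit into the matrix and form a kernel space of that
    dimension. *)
Lemma subresultant_mx_corank :
  ((size g).-1 - k <= m - k + (n - k) - \rank M)%N.
Proof.
have [|/ltnW le_kg] := leqP (size g).-1 k; first by rewrite -subn_eq0 => /eqP->.
have le_g_m : ((size g).-1 <= m)%N.
  by rewrite -ltnS prednK ?size_poly_gt0 // -size_v dvdp_leq ?dvdp_gcdr.
have le_g_n : ((size g).-1 <= n)%N.
  by rewrite -ltnS prednK ?size_poly_gt0 // -size_u dvdp_leq ?dvdp_gcdl.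
set d := ((size g).-1 - k)%N.
pose K : 'M[F]_(d, m - k + (n - k)) :=
  row_mx (lin1_mx (poly_rV \o (v %/ g) \o* rVpoly))
         (lin1_mx (poly_rV \o (- (u %/ g)) \o* rVpoly)).
have size_c (c : 'rV[F]_d) : (size (rVpoly c) <= d)%N by apply: size_poly.
have size_cv (c : 'rV[F]_d) : (size (rVpoly c * (v %/ g))%R <= m - k)%N.
  apply: leq_trans (size_polyMleq _ _) _; rewrite size_v'.
  by have := size_c c; rewrite /d; lia.
have size_cu (c : 'rV[F]_d) : (size (rVpoly c * (- (u %/ g)))%R <= n - k)%N.
  apply: leq_trans (size_polyMleq _ _) _; rewrite size_polyN size_u'.
  by have := size_c c; rewrite /d; lia.
have KE (c : 'rV[F]_d) : c *m K =
    row_mx (poly_rV (rVpoly c * (v %/ g))) (poly_rV (rVpoly c * (- (u %/ g)))).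
  by rewrite mul_mx_row !mul_rV_lin1.
have free_K : row_free K.
  apply: inj_row_free => c; rewrite KE => /eqP.
  rewrite row_mx_eq0 => /andP[/eqP cv0 _]; apply: (can_inj rVpolyK).
  move: cv0 => /(congr1 rVpoly); rewrite poly_rV_K // !linear0 => /eqP.
  by rewrite mulf_eq0 -[v %/ g == 0]size_poly_eq0 size_v' orbF => /eqP.
have KM0 : K *m M = 0.
  apply/row_matrixP => i; rewrite row_mul row0; apply/rowP => j.
  rewrite mul_subresultant_mx [RHS]mxE rowE KE row_mxKl row_mxKr !poly_rV_K //.
  rewrite {1}uE {2}vE; set p := rVpoly _; set u' := u %/ g; set v' := v %/ g.
  by rewrite mulrN mulNr !mulrA (mulrAC p) subrr coef0.
have := mulmx0_rank_max KM0; rewrite (eqP free_K).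
by rewrite /d; lia.
Qed.

End SubresultantRank.

Lemma prod_XsubC_dvdp (F : finFieldType) (e : F -> nat) (p : {poly F}) :
  (forall y, ('X - y%:P) ^+ e y %| p) -> \prod_y ('X - y%:P) ^+ e y %| p.
Proof.
move=> dvd_p; have := index_enum_uniq F; elim: (index_enum F) => [|y s IHs] /=.
  by rewrite big_nil dvd1p.
case/andP=> y_notin_s uniq_s; rewrite big_cons Gauss_dvdp ?dvd_p ?IHs //.
rewrite coprimep_expl // coprimep_sym coprimep_XsubC rootE horner_prod.
rewrite prodf_seq_neq0; apply/allP => z z_in_s /=.
rewrite horner_exp hornerXsubC expf_neq0 // subr_eq0.
by apply: contraNneq y_notin_s => ->.
Qed.

Lemma size_prod_XsubC_exp (F : finFieldType) (e : F -> nat) :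
  size (\prod_y ('X - y%:P) ^+ e y) = (\sum_y e y).+1.
Proof.
rewrite size_prod => [|y _]; last by rewrite expf_neq0 ?polyXsubC_eq0.
have -> : (\sum_y size (('X - y%:P) ^+ e y)%R = \sum_y e y + #|F|)%N.
  rewrite -sum1_card -big_split /=; apply: eq_bigr => y _.
  by rewrite size_exp_XsubC addn1.
by rewrite -addSn addnK.
Qed.

(** For [k = deg_gcd y0] the subresultant is a polynomial in [y] that does not vanish at [y0]. Its
    degree is at most [(n - k) * (m - k)] by the weights, and by the corank bound it vanishes at
    each [y] to order at least [deg_gcd y - k]. *)
Lemma szonyi_weiner (F : finFieldType) (u v : {poly {poly F}}) (n m : nat)
    (y0 : F) (deg_gcd := fun y => (size (gcdp (map_poly (horner_eval y) u)
                                         (map_poly (horner_eval y) v))).-1) :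
    u \is monic -> size u = n.+1 -> (forall i, (size (u`_i)%R <= n.+1 - i)%N) ->
    v \is monic -> size v = m.+1 -> (forall i, (size (v`_i)%R <= m.+1 - i)%N) ->
  (\sum_y (deg_gcd y - deg_gcd y0) <= (n - deg_gcd y0) * (m - deg_gcd y0))%N.
Proof.
move=> mon_u size_u deg_u mon_v size_v deg_v; set k := deg_gcd y0.
set M := subresultant_mx u v k (m - k) (n - k).
(* Monic polynomials keep their degree under specialization, so one matrix format serves all [y]. *)
have size_eval (w : {poly {poly F}}) d y :
    w \is monic -> size w = d.+1 -> size (map_poly (horner_eval y) w) = d.+1.
  by move=> mon_w <-; rewrite size_map_poly_id0 // (monicP mon_w) rmorph1
                              oner_neq0.
have Meval y : map_mx (horner_eval y) M =
    subresultant_mx (map_poly (horner_eval y) u) (map_poly (horner_eval y) v)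
                    k (m - k) (n - k) by apply: map_subresultant_mx.
have gcd_gt0 : (0 < size (gcdp (map_poly (horner_eval y0) u)
                               (map_poly (horner_eval y0) v)))%N.
  by rewrite size_poly_gt0 gcdp_eq0 -size_poly_eq0 (size_eval _ n).
have detM_neq0 : \det M != 0.
  apply/eqP => detM0.
  have := @subresultant_mx_unit _ _ _ n m k (size_eval u n y0 mon_u size_u)
            (size_eval v m y0 mon_v size_v).
  rewrite -Meval unitmxE det_map_mx detM0 rmorph0 unitr0 => unitM.
  by have := unitM (esym (prednK gcd_gt0)).
have le_k_n : (k <= n)%N.
  rewrite -ltnS prednK // -(size_eval u n y0 mon_u size_u) dvdp_leq ?dvdp_gcdl //.
  by rewrite -size_poly_gt0 (size_eval u n).
have le_k_m : (k <= m)%N.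
  rewrite -ltnS prednK // -(size_eval v m y0 mon_v size_v) dvdp_leq ?dvdp_gcdr //.
  by rewrite -size_poly_gt0 (size_eval v m).
have size_detM : (size (\det M) <= ((n - k) * (m - k)).+1)%N.
  (* The coefficient of index [k + j - i] in [u] has degree at most [n + i - (k + j)], and likewise
     for [v] with [m]; this dictates the row and column weights. *)
  apply: (@size_det_weighted _ _ _
    ( fun i => match split i with inl i => n + i | inr i => m + i end)%N
    (fun j => k + j)%N).
    move=> i j; rewrite /M mxE; case: (split i) => {}i; rewrite mxE coefXnM;
      case: ltnP => [|le_ij]; rewrite ?eqxx // -size_poly_gt0.
      by move: (deg_u (k + j - i)%N); move: (size _) => s; lia.
    by move: (deg_v (k + j - i)%N); move: (size _) => s; lia.
  rewrite !big_split_ord /= addnA leq_add //.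
    rewrite mulnC -[X in (X * _)%N]card_ord -sum_nat_const -big_split /=.
    apply: leq_sum => i _; rewrite (unsplitK (inl i)) /=; lia.
  apply: leq_sum => i _; rewrite (unsplitK (inr i)) /=; lia.
have dvd_detM : \prod_y ('X - y%:P) ^+ (deg_gcd y - k) %| \det M.
  apply: prod_XsubC_dvdp => y; apply: dvdp_trans (det_multiplicity_corank M y).
  rewrite dvdp_exp2l // Meval.
  by apply: subresultant_mx_corank; apply: size_eval.
have := leq_trans (dvdp_leq detM_neq0 dvd_detM) size_detM.
by rewrite size_prod_XsubC_exp.
Qed.

(** Once the common factor with exponents [d] is taken out, at every [y] one of the two remaining
    exponents is zero, so the cofactors are coprime. *)
Lemma size_gcdp_prod_XsubC_exp (F : finFieldType) (c e : F -> nat) :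
  size (gcdp (\prod_y ('X - y%:P) ^+ c y) (\prod_y ('X - y%:P) ^+ e y)) =
  (\sum_y minn (c y) (e y)).+1.
Proof.
pose prodX (a : F -> nat) : {poly F} := \prod_y ('X - y%:P) ^+ a y.
pose d y := minn (c y) (e y).
have split_prod a : (forall y, d y <= a y)%N ->
    prodX a = prodX d * prodX (fun y => a y - d y)%N.
  move=> le_da; rewrite /prodX -big_split /=; apply: eq_bigr => y _.
  by rewrite -exprD subnKC.
rewrite -/(prodX c) -/(prodX e) (split_prod c) => [|y]; last exact: geq_minl.
rewrite (split_prod e) => [|y]; last exact: geq_minr.
rewrite (eqp_size (gcdp_mul2l _ _ _)) -size_prod_XsubC_exp -/(prodX d).
suff cop : coprimep (prodX (fun y => c y - d y)%N)
                    (prodX (fun y => e y - d y)%N).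
  by rewrite (eqp_size (eqp_mull _ (_ : _ %= 1))) ?mulr1 // gcdp_eqp1.
apply: (big_ind (fun p => coprimep p _)) => [|p q|y _]; first exact: coprime1p.
  by rewrite coprimepMl => -> ->.
apply: (big_ind (fun q => coprimep _ q)) => [|p q|z _]; first exact: coprimep1.
  by rewrite coprimepMr => -> ->.
have [->|neq_yz] := eqVneq y z.
  rewrite /d /minn; case: ltnP => _; rewrite subnn expr0 ?coprime1p ?coprimep1 //.
apply/coprimep_expl/coprimep_expr/coprimep_XsubC2.
by rewrite subr_eq0 eq_sym.
Qed.

(** * Coordinates in the projective plane *)

Section ProjectivePlane.

Variable F : finFieldType.
Local Notation V := 'rV[F]_3.
Local Open Scope vspace_scope.
Local Open Scope ring_scope.

Implicit Types (p : point F) (l : line F).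

Lemma dim_point p : \dim (val p) = 1%N. Proof. exact/eqP/(valP p). Qed.
Lemma dim_line l : \dim (val l) = 2%N. Proof. exact/eqP/(valP l). Qed.

Lemma point_vlineP p : exists2 w : V, w != 0 & val p = <[w]>.
Proof.
have nz : val p != 0%VS by rewrite -dimv_eq0 dim_point.
exists (vpick (val p)); first by rewrite vpick0.
by apply/esym/eqP; rewrite eqEdim -memvE memv_pick dim_point dim_vline vpick0 nz.
Qed.

Lemma point_of_vline (w : V) : w != 0 -> exists p, val p = <[w]>.
Proof.
move=> nz; have dw : \dim <[w]> == 1%N by rewrite dim_vline nz.
by exists (Sub <[w]> dw).
Qed.

Lemma point_eq p p' : (val p <= val p')%VS -> p = p'.
Proof. by move=> le; apply/val_inj/eqP; rewrite eqEdim le !dim_point. Qed.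

Lemma capv_point p (U : {vspace V}) : ~~ (val p <= U)%VS -> (val p :&: U = 0)%VS.
Proof.
move=> nle; apply/eqP; rewrite -dimv_eq0; apply: contraR nle => nz.
have le : (val p :&: U <= val p)%VS by apply: capvSl.
suff <- : (val p :&: U = val p)%VS by apply: capvSr.
by apply/eqP; rewrite eqEdim le dim_point lt0n.
Qed.

Lemma dim_add_point p (U : {vspace V}) :
  ~~ (val p <= U)%VS -> \dim (val p + U)%VS = (\dim U).+1.
Proof. by move=> nle; rewrite dimv_disjoint_sum ?capv_point ?dim_point. Qed.

Lemma line_through p p' : p != p' -> exists l, val l = (val p + val p')%VS.
Proof.
move=> ne; have d2 : \dim (val p + val p')%VS == 2%N.
  by rewrite dim_add_point ?dim_point //; apply: contra ne => /point_eq->.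
by exists (Sub (val p + val p')%VS d2).
Qed.

Lemma line_eq p p' l l' : p != p' ->
  p \in points_on l -> p' \in points_on l ->
  p \in points_on l' -> p' \in points_on l' -> l = l'.
Proof.
rewrite !inE => ne pl pl' pl2 pl2'.
have dim2 : \dim (val p + val p')%VS = 2%N.
  by rewrite dim_add_point ?dim_point //; apply: contra ne => /point_eq->.
have E (m : line F) : (val p <= val m)%VS -> (val p' <= val m)%VS ->
    (val p + val p' = val m)%VS.
  by move=> h h'; apply/eqP; rewrite eqEdim subv_add h h' dim_line dim2.
by apply: val_inj; rewrite -(E l) // -(E l').
Qed.

(** By Grassmann's formula: two distinct planes of a space of dimension 3 span it and meet in
    dimension 1. *)
Lemma card_points_onI l l' :
  l != l' -> #|points_on l :&: points_on l'|%SET = 1%N.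
Proof.
move=> ne; have nle : ~~ (val l <= val l')%VS.
  apply: contra ne => le; apply/eqP/val_inj/eqP.
  by rewrite eqEdim le !dim_line.
have dim_sum : (2 < \dim (val l + val l')%VS)%N.
  rewrite ltnNge; apply: contra nle => le2.
  suff -> : val l' = (val l + val l')%VS by apply: addvSl.
  by apply/eqP; rewrite eqEdim addvSr dim_line.
have := dimv_sum_cap (val l) (val l'); rewrite !dim_line.
have le3 : (\dim (val l + val l')%VS <= 3)%N.
  by apply: leq_trans (dimvS (subvf _)) _; rewrite dimvf.
move=> dim_cap; have d1 : \dim (val l :&: val l')%VS == 1%N.
  by apply/eqP; move: dim_cap; lia.
pose r : point F := Sub (val l :&: val l')%VS d1.
rewrite (_ : (_ :&: _)%SET = [set r]) ?cards1 //.
apply/setP => p; rewrite !inE -subv_cap; apply/idP/eqP => [le|->]; last first.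
  by rewrite SubK.
by apply: point_eq; rewrite SubK.
Qed.

(** An affine parameter on a projective line with one point removed. It serves both for the slopes
    at infinity and for the points of the vertical axis. *)
Lemma pencil_param (e f : V) : e \notin <[f]> -> f != 0 ->
  exists dir : F -> point F,
    [/\ injective dir, forall m, val (dir m) = <[e + m *: f]>,
        forall m, val (dir m) <> <[f]>
      & forall p, (val p <= <[e]> + <[f]>)%VS -> val p <> <[f]> ->
          exists m, p = dir m].
Proof.
move=> e_f f_neq0.
have nz m : e + m *: f != 0.
  apply: contraNneq e_f => /eqP; rewrite addr_eq0 => /eqP->.
  by rewrite rpredN memvZ ?memv_line.
have /fin_all_exists[dir dirE] m := point_of_vline (nz m).
have dir_f m : val (dir m) <> <[f]>.
  move=> E; case/negP: e_f; rewrite -[e](addrK (m *: f)).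
  by rewrite rpredB ?memvZ ?memv_line // -E dirE memv_line.
exists dir; split => // [m m' E|p le ne].
  apply/eqP/negPn/negP => ne; apply: (dir_f m); apply/eqP.
  rewrite eq_sym eqEdim dim_point dim_vline f_neq0 andbT -memvE.
  have : (m - m') *: f \in val (dir m).
    rewrite (_ : _ *: _ = (e + m *: f) - (e + m' *: f)); last first.
      by rewrite opprD addrACA subrr add0r scalerBl.
    by rewrite rpredB // ?dirE ?memv_line // -dirE E dirE memv_line.
  by rewrite rpredZeq subr_eq0 (negPf ne).
have [w w_neq0 pE] := point_vlineP p.
have /memv_addP[a /vlineP[c ->] [b /vlineP[d ->] wE]] : w \in (<[e]> + <[f]>)%VS.
  by rewrite memvE -pE.
have [c0|c_neq0] := eqVneq c 0.
  case: ne; apply/eqP; rewrite eqEdim dim_point dim_vline f_neq0 andbT pE -memvE.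
  by rewrite wE c0 scale0r add0r memvZ ?memv_line.
exists (c^-1 * d); apply/esym/point_eq; rewrite dirE pE -memvE.
have -> : e + (c^-1 * d) *: f = c^-1 *: w.
  by rewrite wE scalerDr !scalerA mulVf // scale1r.
by rewrite memvZ ?memv_line.
Qed.

(* With [l] at infinity and [p0] the vertical direction, [dir m] is the point at
   infinity of slope [m], [ln m b] the line [Y = m X + b], and [(x p, y p)] are
   the affine coordinates of a point [p] off [l]. *)
Lemma frame p0 l : p0 \in points_on l ->
  exists (dir : F -> point F) (ln : F -> F -> line F) (x y : point F -> F),
  [/\ injective dir, points_on l :\ p0 = [set dir m | m : F],
      forall m, injective (ln m),
      forall m, [set l' | dir m \in points_on l'] :\ l = [set ln m b | b : F]
    & forall p m b, p \notin points_on l ->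
        (p \in points_on (ln m b)) = (b == y p - m * x p)].
Proof.
rewrite inE => p0l; have [e2 e2_neq0 p0E] := point_vlineP p0.
have [e1 e1l e1p0] : exists2 e1, e1 \in val l & e1 \notin <[e2]>.
  apply/subvPn; apply/negP => /dimvS; rewrite dim_line dim_vline e2_neq0 //.
have [e0 _ e0l] : exists2 e0, e0 \in fullv & e0 \notin val l.
  by apply/subvPn; apply/negP => /dimvS; rewrite dim_line dimvf.
have e2l : e2 \in val l by rewrite memvE -p0E.
have e1_neq0 : e1 != 0 by apply: contraNneq e1p0 => ->; rewrite mem0v.
have e0_neq0 : e0 != 0 by apply: contraNneq e0l => ->; rewrite mem0v.
have lE : val l = (<[e1]> + <[e2]>)%VS.
  apply/eqP; rewrite eq_sym eqEdim subv_add -!memvE e1l e2l dim_line /=.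
  have [p1 p1E] := point_of_vline e1_neq0.
  by rewrite -p1E dim_add_point ?dim_vline ?e2_neq0 // p1E -memvE.
have [dir [dir_inj dirE dir_p0 dir_onto]] := pencil_param e1p0 e2_neq0.
have e0e2 : e0 \notin <[e2]>.
  by apply: contra e0l; rewrite memvE => /subv_trans; apply; rewrite -p0E.
(* [org b] is the affine point [(0, b)]; joining it to [dir m] makes [b] the intercept of
   [ln m b]. *)
have [org [_ orgE _ _]] := pencil_param e0e2 e2_neq0.
have dir_l m : (val (dir m) <= val l)%VS.
  by rewrite dirE -memvE rpredD // memvZ.
have org_l b : ~~ (val (org b) <= val l)%VS.
  rewrite orgE -memvE; apply: contra e0l => /rpredB/(_ (memvZ b e2l)).
  by rewrite addrK.
have /fin_all_exists[ln lnE] m : exists lnm : F -> line F,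
    forall b, val (lnm b) = (val (dir m) + val (org b))%VS.
  apply: (@fin_all_exists _ (fun=> line F)
    (fun b l1 => val l1 = (val (dir m) + val (org b))%VS)) => b.
  apply: line_through.
  by apply: contraNneq (org_l b) => <-.
have dir_ln m b : (val (dir m) <= val (ln m b))%VS by rewrite lnE addvSl.
have org_ln m b : (val (org b) <= val (ln m b))%VS by rewrite lnE addvSr.
have ln_neq m b : ln m b != l by apply: contraNneq (org_l b) => <-.
have e2_ln m b : e2 \notin val (ln m b).
  rewrite memvE -p0E; apply: contra (ln_neq m b) => p0ln; apply/eqP.
  apply: (@line_eq p0 (dir m)); rewrite ?inE //.
  by apply/eqP => E; apply: (dir_p0 m); rewrite -E.
have ln_inj m : injective (ln m).
  move=> b b' E; apply/eqP/negPn/negP => ne; case/negP: (e2_ln m b).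
  have : (b - b') *: e2 \in val (ln m b).
    rewrite (_ : _ *: _ = (e0 + b *: e2) - (e0 + b' *: e2)); last first.
      by rewrite opprD addrACA subrr add0r scalerBl.
    by rewrite rpredB // memvE -orgE // E.
  by rewrite rpredZeq subr_eq0 (negPf ne).
have fullE : (<[e0]> + val l)%VS = fullv.
  have [p1 p1E] := point_of_vline e0_neq0.
  apply/eqP; rewrite eqEdim subvf -p1E dim_add_point ?dimvf ?dim_line //.
  by rewrite p1E -memvE.
(* The condition sits inside the existential so that choice applies to all points; coordinates on
   [l] are arbitrary. *)
have /fin_all_exists[xy xyE] p : exists xy : F * F, p \notin points_on l ->
    val p = <[e0 + xy.1 *: e1 + xy.2 *: e2]>.
  have [w w_neq0 pE] := point_vlineP p.
  have : w \in (<[e0]> + val l)%VS by rewrite fullE memvf.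
  rewrite lE => /memv_addP[_ /vlineP[c ->]] [z] /memv_addP.
  move=> [_ /vlineP[a ->]] [_ /vlineP[b ->]] -> wE.
  exists (c^-1 * a, c^-1 * b); rewrite inE pE -memvE => w_l.
  have c_neq0 : c != 0.
    apply: contraNneq w_l => c0.
    by rewrite wE c0 scale0r add0r rpredD ?memvZ.
  have -> : e0 + (c^-1 * a, c^-1 * b).1 *: e1 + (c^-1 * a, c^-1 * b).2 *: e2 =
      c^-1 *: w.
    by rewrite wE -addrA !scalerDr !scalerA mulVf // scale1r.
  apply/eqP; rewrite eq_sym eqEdim -memvE memvZ ?memv_line // !dim_vline.
  by rewrite scaler_eq0 invr_eq0 (negPf c_neq0) (negPf w_neq0).
exists dir, ln, (fun p => (xy p).1), (fun p => (xy p).2).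
have mem_ln p m b : p \notin points_on l ->
    (p \in points_on (ln m b)) = (b == (xy p).2 - m * (xy p).1).
  move=> /xyE pE; rewrite inE pE -memvE; set x := (xy p).1; set y := (xy p).2.
  (* The first two summands lie in [ln m b] and [e2] does not, so membership amounts to the
     vanishing of the coefficient of [e2]. *)
  have -> : e0 + x *: e1 + y *: e2 =
      (e0 + b *: e2) + x *: (e1 + m *: e2) + (y - m * x - b) *: e2.
    rewrite scalerDr scalerA -!addrA; congr (_ + _).
    rewrite [in RHS]addrCA; congr (_ + _); rewrite -!scalerDl; congr (_ *: _).
    ring.
  have ln_org : (e0 + b *: e2) + x *: (e1 + m *: e2) \in val (ln m b).
    by rewrite rpredD ?memvZ // memvE -?orgE -?dirE.
  rewrite rpredDl // rpredZeq (negPf (e2_ln m b)) orbF subr_eq0.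
  by rewrite eq_sym.
split => //.
- apply/setP => p; rewrite !inE; apply/andP/imsetP => [[ne pl]|[m _ ->]].
    have [|E|m ->] := dir_onto p; first by rewrite -lE.
      by case/eqP: ne; apply: val_inj; rewrite E.
    by exists m.
  rewrite dir_l; split=> //; apply/eqP => E; apply: (dir_p0 m); rewrite E //.
- move=> m; apply/setP => l'; rewrite !inE; apply/andP/imsetP => [[ne ml']|].
    have nle : ~~ (val l' <= val l)%VS.
      apply: contra ne => le; apply/eqP/val_inj/eqP.
      by rewrite eqEdim le !dim_line.
    have [w wl' wl] := subvPn nle.
    have [|p pE] := @point_of_vline w.
      by apply: contraNneq wl => ->; rewrite mem0v.
    have pl : p \notin points_on l by rewrite inE pE -memvE.
    exists ((xy p).2 - m * (xy p).1) => //.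
    have p_ln : p \in points_on (ln m ((xy p).2 - m * (xy p).1)).
      by rewrite mem_ln.
    apply: (@line_eq p (dir m)) => //; rewrite ?inE ?dir_ln //.
      by apply: contraNneq pl => ->; rewrite inE.
    by rewrite pE -memvE.
  by move=> [b _ ->].
Qed.

End ProjectivePlane.

(** * Products of linear factors and their fibres *)

(** Each factor has total degree at most 1 in the two variables, so the product has total degree at
    most [size r]. *)
Lemma size_coef_prod_XsubC (R : idomainType) (I : Type) (r : seq I)
    (c : I -> {poly R}) (i : nat) :
    (forall s, size (c s) <= 2)%N ->
  (size ((\prod_(s <- r) ('X - (c s)%:P))`_i)%R <= (size r).+1 - i)%N.
Proof.
move=> size_c; elim: r i => [|s r IHr] i /=.
  by rewrite big_nil coef1; case: i => [|i]; rewrite ?size_poly1 ?size_poly0.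
rewrite big_cons mulrBl coefB coefXM coefCM.
apply: leq_trans (size_polyD _ _) _; rewrite geq_max size_polyN.
apply/andP; split.
  by case: i => [|i]; rewrite ?size_poly0 //= subSS; apply: IHr.
set w := (\prod_(t <- r) ('X - (c t)%:P))`_i; have := IHr i; rewrite -/w.
have [->|w_neq0] := eqVneq w 0; first by rewrite mulr0 size_poly0.
have := size_polyMleq (c s) w; have := size_c s.
have : (0 < size w)%N by rewrite size_poly_gt0.
move: (size (c s * w)) (size (c s)) (size w) (size r) => a b d e; lia.
Qed.

Lemma prod_XsubC_fibers (F : finFieldType) (I : finType) (A : {set I})
    (f : I -> F) :
  \prod_(s in A) ('X - (f s)%:P) =
  \prod_b ('X - b%:P) ^+ #|[set s in A | b == f s]|.
Proof.
rewrite (partition_big f xpredT) //=; apply: eq_bigr => b _.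
rewrite -prodr_const; apply: eq_big => [s|s /andP[_ /eqP->]] //.
by rewrite !inE eq_sym.
Qed.

(** * Indices of lines and points *)

Section Index.

Variable F : finFieldType.
Local Notation q := #|F|.
Local Open Scope nat_scope.

Implicit Types (p : point F) (l : line F) (S : {set point F}).

Definition line_index S l := 2 - #|points_on l :&: S|.
Definition point_index S p :=
  \sum_(l : line F | p \in points_on l) line_index S l.
Definition total_index S := \sum_(l : line F) line_index S l.

Lemma point_on_line l : exists p, p \in points_on l.
Proof.
have : (vpick (val l) != 0)%R.
  by rewrite vpick0 -dimv_eq0 dim_line.
move/point_of_vline => [p pE]; exists p.
by rewrite inE pE -memvE memv_pick.
Qed.

Lemma card_points_on l : #|points_on l| = q.+1.
Proof.
have [p pl] := point_on_line l.
have [dir [_ [_ [_ [dir_inj imE _ _ _]]]]] := frame pl.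
by rewrite (cardsD1 p) pl imE card_imset // add1n.
Qed.

Lemma exists_other_point p : exists p', p' != p.
Proof.
have /subvPn[w _ wp] : ~~ (fullv <= val p)%VS.
  by apply/negP => /dimvS; rewrite dim_point dimvf.
have [|p' pE] := @point_of_vline _ w.
  by apply: contraNneq wp => ->; rewrite mem0v.
by exists p'; apply: contraNneq wp => <-; rewrite pE memv_line.
Qed.

Lemma card_lines_through p : #|[set l | p \in points_on l]| = q.+1.
Proof.
have [p' ne] := exists_other_point p; have [l lE] := line_through ne.
have pl : p \in points_on l by rewrite inE lE addvSr.
have p'l : p' \in points_on l by rewrite inE lE addvSl.
have [dir [ln [_ [_ [dir_inj imE ln_inj lnE _]]]]] := frame p'l.
have /imsetP[m _ pE] : p \in [set dir m | m : F].
  by rewrite -imE in_setD1 eq_sym ne.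
by rewrite (cardsD1 l) inE pl pE lnE card_imset // add1n.
Qed.

(** Write [t] for the index of [p], a point of slope [m0]. Since [2 * q - D m0 = t], the
    Szonyi-Weiner lemma bounds the sum of [t - point_index S (dir m)] over the [N] slopes outside
    [S] by [(#|T| - D m0) * t]. The subtracted indices add up to at most [total_index S], and [N]
    and [#|T|] are known from [l] and [S]. *)
Lemma point_index_quadratic S p l :
    p \notin S -> p \in points_on l -> 1 < #|points_on l :&: S| ->
  point_index S p * (3 * q + 1) <=
  total_index S + point_index S p * #|S| + point_index S p * point_index S p.
Proof.
move=> pS pl card_lS.
have /set0Pn[p0] : points_on l :&: S != set0 by rewrite -card_gt0 ltnW.
rewrite inE => /andP[p0l p0S].
have [dir [ln [x [y [dir_inj dirE ln_inj lnE mem_ln]]]]] := frame p0l.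
have /imsetP[m0 _ pE] : p \in [set dir m | m : F].
  by rewrite -dirE in_setD1 pl andbT; apply: contraNneq pS => ->.
have dir_l m : dir m \in points_on l.
  have : dir m \in points_on l :\ p0 by rewrite dirE imset_f.
  by rewrite in_setD1 => /andP[].
have dir_ln m b : ln m b != l /\ dir m \in points_on (ln m b).
  have : ln m b \in [set ln m b | b : F] by apply: imset_f.
  by rewrite -lnE !inE => /andP[].
have idx_l : line_index S l = 0 by rewrite /line_index; lia.
have idxE m : point_index S (dir m) = \sum_b line_index S (ln m b).
  rewrite /point_index (bigD1 l) //= idx_l add0n -(big_imset _ (in2W (@ln_inj m))).
  by apply: eq_bigl => l'; rewrite -lnE !inE andbC.
pose T := S :\: points_on l.
(* The inner variable is the slope: at slope [m] the roots of [u] are the intercepts of the lines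
   through the points of [T]. Listing the field twice in [v] gives each intercept multiplicity 2
   while keeping linear factors. *)
pose u : {poly {poly F}} :=
  (\prod_(s <- enum T) ('X - ((y s)%:P - x s *: 'X)%:P))%R.
pose v : {poly {poly F}} := (\prod_(b <- enum F ++ enum F) ('X - b%:P%:P))%R.
pose D m := (size (gcdp (map_poly (horner_eval m) u)
                        (map_poly (horner_eval m) v))).-1.
have size_u : size u = #|T|.+1 by rewrite size_prod_XsubC -cardE.
have size_v : size v = (2 * q).+1.
  by rewrite size_prod_XsubC size_cat -cardE mul2n addnn.
have deg_u i : size (u`_i)%R <= #|T|.+1 - i.
  rewrite cardE; apply: size_coef_prod_XsubC => s.
  apply: leq_trans (size_polyD _ _) _; rewrite geq_max size_polyN size_polyC.
  by rewrite (leq_trans (size_scale_leq _ _)) ?size_polyX //; case: eqP.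
have deg_v i : size (v`_i)%R <= (2 * q).+1 - i.
  have -> : 2 * q = size (enum F ++ enum F).
    by rewrite size_cat -cardE mul2n addnn.
  by apply: size_coef_prod_XsubC => b; rewrite size_polyC; case: eqP.
have SW : \sum_m (D m - D m0) <= (#|T| - D m0) * (2 * q - D m0).
  apply: (szonyi_weiner m0 _ size_u deg_u _ size_v deg_v);
  exact: monic_prod_XsubC.
have evu m : map_poly (horner_eval m) u =
    (\prod_b ('X - b%:P) ^+ #|[set s in T | b == y s - m * x s]|)%R.
  rewrite -prod_XsubC_fibers rmorph_prod /= big_enum; apply: eq_bigr => s _.
  rewrite rmorphB /= map_polyX map_polyC /=.
  by rewrite /horner_eval hornerD hornerN hornerZ hornerC hornerX (mulrC m).
have evv m : map_poly (horner_eval m) v = (\prod_b ('X - b%:P) ^+ 2)%R.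
  rewrite rmorph_prod /= big_cat /= !big_enum -big_split /=.
  apply: eq_bigr => b _.
  by rewrite rmorphB /= map_polyX map_polyC /= /horner_eval hornerC.
have DE m : D m = \sum_b minn #|[set s in T | b == (y s - m * x s)%R]| 2.
  by rewrite /D evu evv size_gcdp_prod_XsubC_exp.
(* The line [ln m b] meets [l] only in [dir m]; if that point is outside [S], all points of [S] on
   the line are affine. *)
have T_fiber m b : dir m \notin S ->
    [set s in T | b == (y s - m * x s)%R] = points_on (ln m b) :&: S.
  move=> dirS; apply/setP => s; rewrite in_setI [LHS]inE in_setD.
  case sS: (s \in S); last by rewrite !andbF.
  case: (boolP (s \in points_on l)) => sl /=; last by rewrite mem_ln ?andbT.
  apply/esym/negP => /andP[s_ln _]; have [ne dirln] := dir_ln m b.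
  case/eqP: ne; apply: (@line_eq _ s (dir m)) => //.
  by apply: contraNneq dirS => <-.
(* On each of the [q] lines of slope [m], [minn c 2 + (2 - c) = 2]. *)
have D_idx m : dir m \notin S -> D m + point_index S (dir m) = 2 * q.
  move=> dirS; rewrite DE idxE -big_split /= mulnC -sum_nat_const.
  by apply: eq_bigr => b _; rewrite T_fiber // /line_index; move: #|_| => c; lia.
(* This makes the truncated subtraction [#|T| - D m0] a true one. *)
have D_le : D m0 <= #|T|.
  have sz : size (map_poly (horner_eval m0) u) = #|T|.+1.
    rewrite size_map_poly_id0 // (monicP (monic_prod_XsubC _ _ _)).
    by rewrite rmorph1 oner_neq0.
  have nz : map_poly (horner_eval m0) u != 0%R by rewrite -size_poly_gt0 sz.
  by rewrite /D -subn1 leq_subLR add1n -sz dvdp_leq ?dvdp_gcdl.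
clearbody D; rewrite pE in pS *; set t := point_index S (dir m0).
pose N := #|[set m | dir m \notin S]|.
have le_sum : \sum_(m | dir m \notin S) (t - point_index S (dir m)) <=
    \sum_m (D m - D m0).
  rewrite [X in _ <= X](bigID (fun m => dir m \notin S)) /=.
  apply: leq_trans (leq_addr _ _); apply: leq_sum => m dirS.
  have := D_idx _ dirS; have := D_idx _ pS; rewrite -/t.
  move: (point_index S (dir m)) (D m) (D m0) t => i a b c; lia.
have sum_le_total :
    \sum_(m | dir m \notin S) point_index S (dir m) <= total_index S.
  have ln2_inj : injective (fun mb : F * F => ln mb.1 mb.2).
    move=> [m b] [m' b'] /= lnEq; have [Em|ne] := eqVneq m m'.
      by move: lnEq; rewrite Em => /ln_inj->.
    have [neq dirln] := dir_ln m b; case/eqP: neq.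
    apply: (@line_eq _ (dir m) (dir m')) => //; last by rewrite lnEq (dir_ln _ _).2.
    by rewrite (inj_eq dir_inj).
  apply: (@leq_trans (\sum_m \sum_b line_index S (ln m b))).
    rewrite [X in _ <= X](bigID (fun m => dir m \notin S)) /=.
    by apply: leq_trans (leq_addr _ _); apply: leq_sum => m _; rewrite idxE.
  rewrite pair_big /= -(big_imset _ (in2W ln2_inj)) /=.
  rewrite /total_index [X in _ <= X](bigID
    (mem [set ln mb.1 mb.2 | mb in [pred mb : F * F | true]])).
  exact: leq_addr.
(* As [p0] is in [S], every point of [l] outside [S] has a slope, so [N] counts all of them. *)
have cardN : N + #|points_on l :&: S| = q.+1.
  rewrite -(card_points_on l) -(cardsID S (points_on l)) addnC; congr (_ + _).
  rewrite /N -(card_imset _ dir_inj); apply: eq_card => s.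
  apply/imsetP/idP => [[m] | ].
    by rewrite inE => dirS ->; rewrite in_setD dirS dir_l.
  rewrite in_setD => /andP[sS sl].
  have /imsetP[m _ sE] : s \in [set dir m | m : F].
    by rewrite -dirE in_setD1 sl andbT; apply: contraNneq sS => ->.
  by exists m; rewrite // inE -sE.
have cardS : #|S| = #|points_on l :&: S| + #|T| by rewrite setIC cardsID.
have Nt : N * t <= \sum_(m | dir m \notin S) (t - point_index S (dir m)) +
    \sum_(m | dir m \notin S) point_index S (dir m).
  rewrite -big_split /= -sum_nat_const big_mkcond /= [X in _ <= X]big_mkcond.
  by apply: leq_sum => m _; rewrite inE; case: ifP => // _; lia.
have Dt := D_idx _ pS; rewrite -/t in Dt.
have {SW le_sum sum_le_total}Nt_le : N * t <= (#|T| - D m0) * t + total_index S.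
  apply: leq_trans Nt _; apply: leq_add => //; apply: leq_trans le_sum _.
  by have := SW; rewrite -{1}Dt addKn.
have -> : 3 * q + 1 = N + #|points_on l :&: S| + (D m0 + t) by lia.
rewrite cardS -(subnK D_le); move: (#|T| - D m0) Nt_le => e.
move: (total_index S) (D m0) #|_| => d d0 s; nia.
Qed.

End Index.

(** * Counting indices, and the completion to a double blocking set *)

Section IndexCount.

Variable F : finFieldType.
Local Notation q := #|F|.
Local Open Scope nat_scope.

Implicit Types (p : point F) (l : line F).

Variable S : {set point F}.

Lemma line_indexE l : line_index S l = 2 * skew S l + tangent S l.
Proof.
rewrite /line_index /skew /tangent -setI_eq0 -cards_eq0.
by case: #|_| => [|[|c]] //=.
Qed.

Lemma line_index_le_point_index p l :
  p \in points_on l -> line_index S l <= point_index S p.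
Proof. by move=> pl; rewrite /point_index (bigD1 l) //= leq_addr. Qed.

(** Double counting: another line meets [l] once, while [l] itself is counted at its [q + 1]
    points. *)
Lemma sum_point_index_line l :
  \sum_(p in points_on l) point_index S p = total_index S + q * line_index S l.
Proof.

under eq_bigr => p _ do rewrite /point_index big_mkcond.
rewrite exchange_big /= /total_index (bigD1 l) //= [in RHS](bigD1 l) //=.
have -> : \sum_(p in points_on l)
    (if p \in points_on l then line_index S l else 0) = q.+1 * line_index S l.
  rewrite -big_mkcondr -(card_points_on l) -sum_nat_const.
  by apply: eq_bigl => p; rewrite andbb.
rewrite mulSn [in RHS]addnAC; congr (_ + _); apply: eq_bigr => l' ne.
rewrite -big_mkcondr sum_nat_cond_const.
rewrite (_ : [set _ in _ | _] = points_on l' :&: points_on l).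
  by rewrite card_points_onI ?mul1n.
by apply/setP => p; rewrite in_setI inE andbC.
Qed.

Lemma sum_line_index_two_points p p' :
  p != p' ->
  \sum_(l | (p \in points_on l) && (p' \in points_on l)) line_index S l <= 2.
Proof.
move=> ne.
pose J := [set l : line F | (p \in points_on l) && (p' \in points_on l)].
have J1 : #|J| <= 1.
  have inJ l : (l \in J) = (p \in points_on l) && (p' \in points_on l).
    by rewrite [LHS]in_set.
  apply/card_le1_eqP => l l'; rewrite !inJ => /andP[? ?] /andP[? ?].
  exact: (line_eq ne).
apply: (@leq_trans (#|J| * 2)); last by rewrite -[X in _ <= X]mul1n leq_mul2r J1.
rewrite -sum_nat_const; rewrite [X in _ <= X](eq_bigl _ _ (fun l => in_set _ l)).
by apply: leq_sum => l _; apply: leq_subr.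
Qed.

(** A line through several of the points is compensated by the pairwise sums, each at most 2 because
    a single line joins two points. *)
Lemma sum_three_point_index p1 p2 p3 :
    p1 != p2 -> p2 != p3 -> p3 != p1 ->
  point_index S p1 + point_index S p2 + point_index S p3 <= total_index S + 6.
Proof.
move=> ne12 ne23 ne31.
have := leq_add (leq_add (sum_line_index_two_points ne12)
  (sum_line_index_two_points ne23)) (sum_line_index_two_points ne31).
rewrite -(leq_add2l (total_index S)); apply: leq_trans.
rewrite /point_index /total_index !(big_mkcond (fun l => _ \in _)).
rewrite !(big_mkcond (fun l => _ && _)) /= -!big_split /=.
apply: leq_sum => l _; move: (line_index S l) => i.
by do 3![case: (_ \in _)] => /=; lia.
Qed.

(** If no line through [p] meets [S] twice, each of the [q + 1] lines through [p] has positive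
    index. *)
Lemma point_index_dichotomy p : p \notin S ->
  q < point_index S p \/
  point_index S p * (3 * q + 1) <=
  total_index S + point_index S p * #|S| + point_index S p * point_index S p.
Proof.
move=> pS.
have [/exists_inP[l pl card_l]|no_l] :=
    boolP [exists l : line F in [set l | p \in points_on l],
             1 < #|points_on l :&: S|].
  by right; rewrite in_set in pl; apply: point_index_quadratic card_l.
left; rewrite -(card_lines_through p) -sum1dep_card.
apply: leq_sum => l pl; rewrite /line_index subn_gt0 ltnS leqNgt.
by apply: contra no_l => card_l; apply/exists_inP; exists l; rewrite // in_set.
Qed.

Hypothesis hS : semi_resolving S.

Lemma card_skew_le1 : #|[set l : line F | skew S l]| <= 1.
Proof. by case/andP: hS. Qed.

Lemma card_tangent_le1 p : p \in S ->
  #|[set l : line F | (p \in points_on l) && tangent S l]| <= 1.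
Proof. by case/andP: hS => _ /forall_inP; apply. Qed.

Lemma point_index_le1 p : p \in S -> point_index S p <= 1.
Proof.
move=> pS; apply: leq_trans (card_tangent_le1 pS).
rewrite -sum1_card [X in _ <= X](eq_bigl (fun l : line F =>
  (p \in points_on l) && tangent S l)) => [|l]; last by rewrite inE.
rewrite big_mkcondr /=; apply: leq_sum => l pl; rewrite /line_index /tangent.
have : 0 < #|points_on l :&: S| by apply/card_gt0P; exists p; rewrite in_setI pl.
by case: #|_| => [|[|c]].
Qed.

Lemma point_index_le p : point_index S p <= q + 2.
Proof.
apply: (@leq_trans (\sum_(l | p \in points_on l) (1 + skew S l))).
  apply: leq_sum => l _; rewrite line_indexE /skew -setI_eq0 -cards_eq0 /tangent.
  by case: #|_| => [|[|c]].
rewrite big_split /= (_ : q + 2 = q.+1 + 1); last by lia.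
apply: leq_add; first by rewrite sum1dep_card card_lines_through.
apply: leq_trans card_skew_le1; rewrite -sum1dep_card big_mkcond /=.
rewrite [X in _ <= X]big_mkcond; apply: leq_sum => l _.
by case: (_ \in _); case: skew.
Qed.

(** Charge each tangent to its point of [S], which has at most one; the only possible skew line adds
    2. *)
Lemma total_index_le : total_index S <= #|S| + 2.
Proof.
rewrite /total_index; under eq_bigr do rewrite line_indexE.
rewrite big_split /= -big_distrr /= addnC; apply: leq_add; last first.
  have -> : \sum_(l : line F) skew S l = #|[set l : line F | skew S l]|.
    by rewrite -sum1dep_card [RHS]big_mkcond /=; apply: eq_bigr => l; case: skew.
  by rewrite -[X in _ <= X]muln1 leq_mul2l card_skew_le1.
apply: (@leq_trans (\sum_(p in S)
  #|[set l : line F | (p \in points_on l) && tangent S l]|)).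
  under [X in _ <= X]eq_bigr do rewrite -sum1dep_card big_mkcond.
  rewrite exchange_big /=; apply: leq_sum => l _.
  case: (boolP (tangent S l)) => // /eqP tan_l /=.
  rewrite -big_mkcondr sum1dep_card -[X in X <= _]tan_l.
  by apply/eq_leq/eq_card => p; rewrite in_setI [in RHS]inE andbT andbC.
rewrite -sum1_card; apply: leq_sum => p; exact: card_tangent_le1.
Qed.

(** The quadratic inequality fails at 3 and at [3 * q - 2 - #|S|], which are symmetric about the
    vertex of the parabola, hence also between them. *)
Lemma point_index_gap p : 4 * #|S| + 12 < 9 * q ->
  point_index S p <= 2 \/ minn q.+1 (3 * q - 1 - #|S|) <= point_index S p.
Proof.
move=> cardS; have [pS|pS] := boolP (p \in S).
  by left; apply: leq_trans (point_index_le1 pS) _.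
have [large|quad] := point_index_dichotomy pS; first by right; lia.
have := total_index_le; move: quad; move: (point_index S p) (total_index S).
move=> t d quad le_d; have [|gt2] := leqP t 2; [by left | right].
rewrite geq_min; apply/orP; right; rewrite leqNgt; apply/negP => lt_t.
(* The slacks [a] and [b] measure the distance of [t] to the two ends of the interval; expanding in
   them leaves [a * b] as a nonnegative term to discard. *)
have [a tE] : exists a, t = 3 + a by exists (t - 3); lia.
have [b qE] : exists b, 3 * q = #|S| + t + 2 + b.
  by exists (3 * q - (#|S| + t + 2)); lia.
have : t * (3 * q + 1) = t * #|S| + t * t + 3 * t + t * b by rewrite qE; ring.
have : t * b = 3 * b + a * b by rewrite tE; ring.
lia.
Qed.

Lemma double_blocking_completion : 4 <= q -> 4 * #|S| + 12 < 9 * q ->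
  exists A : {set point F}, #|A| <= 2 /\ double_blocking (S :|: A).
Proof.
move=> q4 cardS.
have [A inA] : exists A : {set point F},
    forall p, (p \in A) = (2 < point_index S p).
  by exists [set p | 2 < point_index S p] => p; rewrite in_set.
have le_total := total_index_le.
exists A; split.
  (* Three large indices sum to at most [#|S| + 8]. This contradicts [4 * #|S| + 12 < 9 * q] if the
     minimum is [3 * q - 1 - #|S|], and together with [4 <= q] if it is [q + 1]. *)
  rewrite leqNgt; apply/negP => /card_gt2P[p1 [p2 [p3 [[]]]]].
  rewrite !inA => gt1 gt2 gt3 [ne12 ne23 ne31].
  have := sum_three_point_index ne12 ne23 ne31.
  have large p : 2 < point_index S p ->
      minn q.+1 (3 * q - 1 - #|S|) <= point_index S p.
    by case: (point_index_gap p cardS) => //; lia.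
  by have := large _ gt1; have := large _ gt2; have := large _ gt3; lia.
have [n nE] : exists n, #|S| = n by exists #|S|.
rewrite nE in cardS le_total.
have quad p : p \notin S -> point_index S p <= 2 ->
    point_index S p * (3 * q + 1) <= total_index S +
      point_index S p * n + point_index S p * point_index S p.
  by rewrite -nE; move=> pS le2; have [|//] := point_index_dichotomy pS; lia.
apply/forallP => l; rewrite leqNgt; apply/negP.
(* Points of [S] have index at most 1, so [A] avoids [S] and the two intersections with [l] can be
   added. *)
have disj : points_on l :&: S :&: (points_on l :&: A) = set0.
  apply/setP => p; rewrite !in_setI in_set0 inA; apply/negP.
  by case/andP => /andP[_ /point_index_le1]; lia.
rewrite setIUr cardsU disj cards0 subn0 => lt2.
have sumE := sum_point_index_line l.
have sumS (c : nat) (B : {set point F}) :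
    \sum_(p in points_on l) (p \in B) * c = #|points_on l :&: B| * c.
  rewrite -big_distrl /=; congr (_ * _).
  rewrite -sum1_card [RHS](eq_bigl _ _ (fun p => in_setI p _ _)) big_mkcondr.
  by apply: eq_bigr => p _; case: (p \in B).
have outside (B : {set point F}) : #|points_on l :&: B| <= 1 ->
    exists2 p, p \in points_on l & p \notin B.
  move=> le1; have : 0 < #|points_on l :\: B|.
    by have := cardsID B (points_on l); rewrite card_points_on; lia.
  by case/card_gt0P=> p; rewrite in_setD => /andP[pB pl]; exists p.
have [lS0|lS1] : #|points_on l :&: S| = 0 \/ #|points_on l :&: S| = 1 by lia.
(* A skew [l] has at most one point in [A], of index at most [q + 2], so summing along [l] gives
   [total_index S <= q + 2]. A point of index exactly 2 forces [6 * q - 2 <= total_index S + 2 * n],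
   which is impossible. *)
- have idx_l : line_index S l = 2 by rewrite /line_index lS0.
  have [|p pl pA] := outside A; first by lia.
  have pS : p \notin S.
    by apply/negP => pS; move: lS0 => /eqP; rewrite cards_eq0 => /eqP/setP/(_ p);
       rewrite in_setI in_set0 pl pS.
  have := line_index_le_point_index pl; rewrite inA -leqNgt in pA.
  have := quad p pS pA; rewrite idx_l => qp ge2.
  have idx2 : point_index S p = 2 by lia.
  rewrite idx2 in qp.
  have : \sum_(p in points_on l) point_index S p <=
      \sum_(p in points_on l) (2 + (p \in A) * q).
    apply: leq_sum => p' _; rewrite inA; have := point_index_le p'.
    by case: ltnP => /=; lia.
  rewrite big_split /= sumS sum_nat_const card_points_on sumE idx_l.
  have leA : #|points_on l :&: A| <= 1 by lia.
  have : #|points_on l :&: A| * q <= q.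
    by rewrite -[X in _ <= X]mul1n leq_mul2r leA orbT.
  by move: (_ * q) => aq; lia.
(* A tangent [l] still met only once has no point in [A], so all indices on it are at most 2. *)
- have idx_l : line_index S l = 1 by rewrite /line_index lS1.
  have idx_le p : p \in points_on l -> point_index S p <= 2.
    move=> pl; rewrite leqNgt -inA; apply/negP => pA.
    have : 0 < #|points_on l :&: A|.
      by apply/card_gt0P; exists p; rewrite in_setI pl.
    lia.
  have [|p pl pS] := outside S; first by lia.
  have := line_index_le_point_index pl; rewrite idx_l => ge1.
  (* With a point of index 2 outside [S], summing along [l] gives [total_index S <= q + 1].
     Otherwise all indices on [l] are at most 1 and [total_index S <= 1]. Each contradicts the
     quadratic inequality, at index 2 and at index 1. *)
  have [/exists_inP[p' p'l /andP[p'S /eqP idx2]]|none] :=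
      boolP [exists p' in points_on l, (p' \notin S) && (point_index S p' == 2)].
    have := quad p' p'S (idx_le _ p'l); rewrite idx2.
    have : \sum_(p in points_on l) (point_index S p + (p \in S) * 1) <=
        \sum_(p in points_on l) 2.
      apply: leq_sum => p1 p1l; case: (boolP (p1 \in S)) => [/point_index_le1|_].
        by lia.
      by have := idx_le _ p1l; lia.
    rewrite big_split /= sumS sum_nat_const card_points_on sumE idx_l lS1.
    by clear -cardS; move: #|F| (total_index S) cardS => k t; lia.
  have idx_le1 p' : p' \in points_on l -> point_index S p' <= 1.
    move=> p'l; have [/point_index_le1 //|p'S] := boolP (p' \in S).
    have := idx_le _ p'l; rewrite leq_eqVlt => /orP[idx2|//].
    by case/exists_inP: none; exists p'; rewrite ?p'S.
  have idx1 : point_index S p = 1 by have := idx_le1 _ pl; lia.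
  have := quad p pS (idx_le _ pl); rewrite idx1.
  have : \sum_(p in points_on l) point_index S p <= \sum_(p in points_on l) 1.
    exact: leq_sum.
  by rewrite sum_nat_const card_points_on sumE idx_l; lia.
Qed.

End IndexCount.

Theorem theorem3 (q : nat) (F : finFieldType) (hF : #|F| = q) (hq : (4 <= q)%N)
    (S : {set point F}) (hS : semi_resolving S)
    (hcard : #|S|%:R < 2 * q%:R + q%:R / 4 - 3 :> rat) :
  exists A : {set point F}, (#|A| <= 2)%N /\ double_blocking (S :|: A).
Proof.
apply: double_blocking_completion; rewrite ?hF //.
(* The integer bound is [hcard] multiplied by 4. *)
rewrite -(ltr_nat rat) natrD !natrM; lra.
Qed.
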